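(* Let $(P,\preceq)$ be an infinite, locally finite lattice, let $x_1,\dots,x_n$ be distinct elements of $P$ such that $x_i\preceq x_j$ implies $i\le j$, and put $S_n=\{x_1,\dots,x_n\}$. Let $f:P\to\mathbb{R}$ take nonnegative values, be order-reversing on $\mathrm{joincl}(S_n)$, and be decreasing in $S_n$ with respect to the indices, i.e. $i\le j\Rightarrow f(x_i)\ge f(x_j)$. Let $\hat\lambda_1\le\hat\lambda_2\le\cdots\le\hat\lambda_n$ be the eigenvalues of the join matrix $[S_n]_f$. Then $\hat\lambda_k\le k f(x_{n-k+1})$ for all $k=1,\dots,n$, and moreover $f(x_1)\le\hat\lambda_n$.
   Context: $\mathrm{joincl}(S_n)$ denotes the smallest subset of $P$ containing $S_n$ and closed under the join $\vee$. $f$ is order-reversing on a set $T$ if $x,y\in T$, $x\preceq y$ implies $f(y)\le f(x)$. The join matrix $[S_n]_f$ is the $n\times n$ real symmetric matrix with $(i,j)$ entry $f(x_i\vee x_j)$. *)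

(* Defs.v *)
From HB Require Import structures.
From mathcomp Require Import all_boot all_order all_algebra.
From mathcomp Require Import classical_sets cardinality reals.

Set Implicit Arguments.
Unset Strict Implicit.
Unset Printing Implicit Defensive.

Import Order.TTheory GRing.Theory Num.Theory.
Local Open Scope classical_set_scope.
Local Open Scope ring_scope.

(* In classical_set_scope and ring_scope, the infix `|` is set union, so the
   lattice join is written Order.join. *)

Definition locally_finite (d : Order.disp_t) (P : latticeType d) : Prop :=
  forall a b : P, finite_set [set c : P | (a <= c <= b)%O].

Definition join_closed (d : Order.disp_t) (P : latticeType d) (C : set P) : Prop :=
  forall a b : P, C a -> C b -> C (Order.join a b).

Definition joincl (d : Order.disp_t) (P : latticeType d) (S : set P) : set P :=
  smallest (@join_closed d P) S.

Definition order_reversing_on (d : Order.disp_t) (P : latticeType d)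
    (R : realType) (T : set P) (f : P -> R) : Prop :=
  forall a b : P, T a -> T b -> (a <= b)%O -> f b <= f a.

Definition join_matrix (d : Order.disp_t) (P : latticeType d) (R : realType)
    (n : nat) (x : 'I_n -> P) (f : P -> R) : 'M[R]_n :=
  \matrix_(i, j) f (Order.join (x i) (x j)).

(* lam lists all n eigenvalues of A, with algebraic multiplicity, in
   nondecreasing order; such a lam exists (and is unique) for A symmetric. *)
Definition ordered_eigenvalues (R : realType) (n : nat) (A : 'M[R]_n)
    (lam : 'I_n -> R) : Prop :=
  char_poly A = \prod_(i < n) ('X - (lam i)%:P)
  /\ (forall i j : 'I_n, (i <= j)%N -> lam i <= lam j).

(* Main.v *)
(** The join matrix A is symmetric and satisfies 0 <= A_ij <= f(x_i).  Diagonalize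
    it over the complex numbers by a unitary matrix.  For each k some nonzero
    vector v supported on the last k coordinates is orthogonal to the
    eigenvectors of the k - 1 smallest eigenvalues, so that
    lambda_k |v|^2 <= v A v^*; since |v_i||v_j| <= (|v_i|^2 + |v_j|^2) / 2,
    the right-hand side is at most k f(x_{n-k+1}) |v|^2.  Finally f(x_1) is
    the diagonal entry A_11, which is at most the largest eigenvalue. *)
Require Import Defs.
From HB Require Import structures.
From mathcomp Require Import all_boot all_order all_algebra.
From mathcomp Require Import classical_sets cardinality reals.
From mathcomp Require Import perm spectral complex ring.

Set Implicit Arguments.
Unset Strict Implicit.
Unset Printing Implicit Defensive.

Import Order.TTheory GRing.Theory Num.Theory.
Local Open Scope ring_scope.

(** * Hermitian matrices: diagonalization and bounds on quadratic forms *)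

Section SpectralBounds.

Local Open Scope sesquilinear_scope.

Lemma char_poly_similar (R : comUnitRingType) n (A P : 'M[R]_n) :
  P \in unitmx -> char_poly (invmx P *m A *m P) = char_poly A.
Proof.
move=> Pu; rewrite /char_poly /char_poly_mx !map_mxM /=.
have VP : map_mx polyC (invmx P) *m map_mx polyC P = 1%:M.
  by rewrite -map_mxM mulVmx // map_mx1.
set Q := map_mx polyC P in VP *; set V := map_mx polyC (invmx P) in VP *.
(* A scalar matrix is its own conjugate, so the whole characteristic matrix factors through [V] and
   [Q]. *)
rewrite [X in \det (X - _)](_ : _ = V *m 'X%:M *m Q); last first.
  by rewrite mul_mx_scalar -scalemxAl VP scalemx1.
by rewrite -mulmxBl -mulmxBr !det_mulmx mulrAC -det_mulmx VP det1 mul1r.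
Qed.

Lemma exists_row_ker (F : fieldType) m n (M : 'M[F]_(n, m)) :
  (m < n)%N -> exists2 v : 'rV[F]_n, v != 0 & v *m M = 0.
Proof.
move=> lt_mn; have : kermx M != 0.
  by rewrite -mxrank_eq0 mxrank_ker subn_eq0 -ltnNge (leq_ltn_trans (rank_leq_col M)).
by move=> /rowV0Pn[v /sub_kermxP vM v0]; exists v.
Qed.

Variable C : numClosedFieldType.

(** The spectral theorem lists the eigenvalues in an uncontrolled order. Unique factorization of the
    characteristic polynomial gives a permutation to [lam], and permuting the rows of the spectral
    matrix realizes it. *)
Lemma hermitian_diagonalization n (A : 'M[C]_n) (lam : 'I_n -> C) :
    A \is hermsymmx -> char_poly A = \prod_(i < n) ('X - (lam i)%:P) ->
  exists2 U : 'M[C]_n, U \is unitarymx & A = U^t* *m diag_mx (\row_i lam i) *m U.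
Proof.
move=> /hermitian_normalmx /orthomx_spectralP.
set P := spectralmx A; set dg := spectral_diag A => AE charA.
have Pu : P \is unitarymx := spectral_unitarymx A.
have : perm_eq [tuple lam i | i < n] [tuple dg 0 i | i < n].
  apply: prod_XsubC_eq; rewrite !big_map -!enumT !big_enum /= -charA AE.
  rewrite char_poly_similar ?unitarymx_unit // char_poly_trig ?diag_mx_is_trig //.
  by apply: eq_bigr => i _; rewrite mxE eqxx.
case/tuple_permP => s /val_inj sE.
have lamE i : lam i = dg 0 (s i).
  by have := congr1 (fun t => tnth t i) sE; rewrite !tnth_mktuple.
exists (row_perm s P).
  apply/unitarymxP; rewrite row_permE trmx_mul map_mxM mulmxA.
  rewrite -[_ *m P *m _]mulmxA (unitarymxP Pu) mulmx1 tr_perm_mx map_perm_mx.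
  by rewrite -perm_mxM mulgV perm_mx1.
rewrite {1}AE invmx_unitary //; apply/matrixP => a b.
rewrite !mul_mx_diag !mxE [LHS](reindex_inj (@perm_inj _ s)) /=.
by apply: eq_bigr => j _; rewrite !mxE lamE.
Qed.

(** For unitary [U], the entries of [v *m U^t*] are the coordinates of [v] in the eigenbasis formed
    by the rows of [U]. *)
Lemma unitary_diag_form n (U : 'M[C]_n) (lam : 'rV[C]_n) (v : 'rV[C]_n) :
  (v *m (U^t* *m diag_mx lam *m U) *m v^t*) 0 0 =
  \sum_i lam 0 i * `|(v *m U^t*) 0 i| ^+ 2.
Proof.
have -> : v *m (U^t* *m diag_mx lam *m U) *m v^t* =
    (v *m U^t*) *m diag_mx lam *m (v *m U^t*)^t*.
  by rewrite trmx_mul map_mxM trmxCK !mulmxA.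
rewrite mul_mx_diag mxE; apply: eq_bigr => i _.
rewrite normCK mulrA [lam 0 i * _]mulrC.
by congr (_ * _); rewrite !mxE.
Qed.

Lemma unitary_norm n (U : 'M[C]_n) (v : 'rV[C]_n) : U \is unitarymx ->
  \sum_i `|(v *m U^t*) 0 i| ^+ 2 = \sum_i `|v 0 i| ^+ 2.
Proof.
have sqE (w : 'rV[C]_n) : (w *m w^t*) 0 0 = \sum_i `|w 0 i| ^+ 2.
  by rewrite mxE; apply: eq_bigr => i _; rewrite !mxE normCK.
by move=> Uu; rewrite -!sqE trmx_mul map_mxM trmxCK mulmxA mulmxKtV.
Qed.

Section Hermitian.

Variables (n : nat) (A : 'M[C]_n) (lam : 'I_n -> C).
Hypothesis A_herm : A \is hermsymmx.
Hypothesis charA : char_poly A = \prod_(i < n) ('X - (lam i)%:P).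
Hypothesis lam_mono : forall i j : 'I_n, (i <= j)%N -> lam i <= lam j.

(* Dimension count: the vectors supported on the last [i + 1] coordinates
   meet the span of the eigenvectors for [lam i, ..., lam (n - 1)]. *)
Lemma exists_tail_vector (i : 'I_n) :
  exists v : 'rV[C]_n, [/\ v != 0, forall j : 'I_n, (j < rev_ord i)%N -> v 0 j = 0
    & lam i * \sum_j `|v 0 j| ^+ 2 <= (v *m A *m v^t*) 0 0].
Proof.
have [U Uu AE] := hermitian_diagonalization A_herm charA.
have le1 : (rev_ord i <= n)%N by exact: ltnW.
have le2 : (i <= n)%N by exact: ltnW.
(* [v *m M = 0] kills the first [n - 1 - i] coordinates of [v] and its components along the first
   [i] eigenvectors: [n - 1] equations in [n] unknowns. *)
pose M : 'M[C]_(n, rev_ord i + i) :=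
  row_mx (colsub (widen_ord le1) 1%:M) (colsub (widen_ord le2) (U^t*)).
have [|v v0] := exists_row_ker M.
  by rewrite /= -ltnS -addSn subnSK // subnK.
rewrite mul_mx_row -row_mx0 => /eq_row_mx[].
rewrite !mulmx_colsub mulmx1 => /rowP v1 /rowP v2.
exists v; split => // [j ltj|].
  by have := v1 (Ordinal ltj); rewrite !mxE => <-; congr (v _ _); exact: val_inj.
(* Termwise in the eigenbasis: monotonicity for [i <= j], a vanishing coordinate for [j < i]. *)
rewrite AE unitary_diag_form -(unitary_norm v Uu) mulr_sumr ler_sum // => j _.
rewrite [X in _ <= X * _]mxE; have [ij|ji] := leqP i j.
  by rewrite ler_wpM2r ?lam_mono // exprn_ge0.
have := v2 (Ordinal ji); rewrite [LHS]mxE [RHS]mxE.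
rewrite (_ : widen_ord _ _ = j); last exact: val_inj.
by move=> ->; rewrite normr0 expr0n !mulr0.
Qed.

(** The diagonal entry is the quadratic form at a unit basis vector, hence a weighted mean of the
    eigenvalues. *)
Lemma diag_le_max_eigenvalue (l : C) (j : 'I_n) :
  (forall i, lam i <= l) -> A j j <= l.
Proof.
move=> lam_le; have [U Uu AE] := hermitian_diagonalization A_herm charA.
pose e : 'rV[C]_n := delta_mx 0 j.
have -> : A j j = (e *m A *m e^t*) 0 0.
  by rewrite -rowE trmx_delta map_delta_mx -colE !mxE.
have e1 : \sum_i `|e 0 i| ^+ 2 = 1.
  rewrite (bigD1 j) //= big1 ?addr0 => [|i /negPf ij].
    by rewrite mxE !eqxx normr1 expr1n.
  by rewrite mxE ij andbF normr0 expr0n.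
rewrite AE unitary_diag_form -[leRHS]mulr1 -e1 -(unitary_norm e Uu) mulr_sumr.
by rewrite ler_sum // => i _; rewrite mxE ler_wpM2r // exprn_ge0.
Qed.

End Hermitian.

Lemma norm_quadratic_form_le n (A : 'M[C]_n) (S : {set 'I_n}) (m : C) (v : 'rV[C]_n) :
    (forall i, i \notin S -> v 0 i = 0) ->
    {in S &, forall i j, `|A i j| <= m} ->
  `|(v *m A *m v^t*) 0 0| <= m * #|S|%:R * \sum_i `|v 0 i| ^+ 2.
Proof.
move=> vS Am.
have -> : (v *m A *m v^t*) 0 0 =
    \sum_(j in S) \sum_(i in S) v 0 i * A i j * (v 0 j)^*.
  rewrite mxE (bigID (mem S)) /= [X in _ + X]big1 ?addr0 => [|j /vS vj]; last first.
    by rewrite !mxE vj conjC0 mulr0.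
  apply: eq_bigr => j _; rewrite !mxE mulr_suml (bigID (mem S)) /=.
  by rewrite [X in _ + X]big1 ?addr0 // => i /vS ->; rewrite !mul0r.
apply: le_trans (ler_norm_sum _ _ _) _.
(* This majorant, from the square of [|v_i| - |v_j|], sums over [S] x [S] to exactly [m * #|S|]
   times the squared norm. *)
have le_sum j : j \in S ->
  `|\sum_(i in S) v 0 i * A i j * (v 0 j)^*| <=
  \sum_(i in S) m * ((`|v 0 i| ^+ 2 + `|v 0 j| ^+ 2) / 2).
  move=> jS; apply: le_trans (ler_norm_sum _ _ _) _; apply: ler_sum => i iS.
  rewrite !normrM norm_conjC mulrAC mulrC.
  apply: ler_pM; rewrite ?mulr_ge0 ?Am //.
  rewrite ler_pdivlMr ?ltr0n // -subr_ge0.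
  have -> : `|v 0 i| ^+ 2 + `|v 0 j| ^+ 2 - `|v 0 i| * `|v 0 j| * 2 =
    (`|v 0 i| - `|v 0 j|) ^+ 2 by ring.
  by rewrite real_exprn_even_ge0 // rpredB ?normr_real.
apply: le_trans (ler_sum _ le_sum) _.
under eq_bigr do rewrite -mulr_sumr -mulr_suml big_split /= sumr_const.
rewrite -mulr_sumr -mulr_suml big_split /= sumr_const -sumrMnl.
have -> : \sum_i `|v 0 i| ^+ 2 = \sum_(i in S) `|v 0 i| ^+ 2.
  rewrite (bigID (mem S)) /= [X in _ + X]big1 ?addr0 // => i /vS ->.
  by rewrite normr0 expr0n.
by rewrite sumrMnl -mulr_natl le_eqVlt; apply/orP; left; apply/eqP; field.
Qed.

End SpectralBounds.

(** Index reversal maps the tail onto the first [i + 1] indices; this count becomes the factor [k]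
    of the bound. *)
Lemma card_tail n (i : 'I_n) : #|[set j : 'I_n | (rev_ord i <= j)%N]| = i.+1.
Proof.
have -> : [set j : 'I_n | (rev_ord i <= j)%N] =
    [set rev_ord (widen_ord (ltn_ord i) k) | k : 'I_i.+1].
  apply/setP => j; rewrite inE; apply/idP/imsetP => [ij|[k _ ->]]; last first.
    by rewrite /= leq_sub2l.
  have lt_ji : (rev_ord j < i.+1)%N.
    by move: ij; rewrite /= ltnS !leq_subLR addSnnS addnC.
  by exists (Ordinal lt_ji) => //; apply: rev_ord_inj; apply: val_inj; rewrite rev_ordK.
rewrite card_imset ?card_ord //.
by move=> a b /rev_ord_inj /(congr1 val) ?; exact: val_inj.
Qed.

(** * Transfer to real symmetric matrices through the complex numbers *)

Section RealSymmetric.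

Variables (R : realType) (n : nat) (A : 'M[R]_n) (lam : 'I_n -> R).
Hypothesis A_sym : A^T = A.
Hypothesis A_eig : ordered_eigenvalues A lam.

Let toC : {rmorphism R -> R[i]} := real_complex R.
Let AC : 'M[R[i]]_n := map_mx toC A.

Let AC_herm : AC \is hermsymmx.
Proof.
apply/is_hermitianmxP; rewrite expr0 scale1r; apply/matrixP => i j.
by rewrite !mxE -[in LHS]A_sym mxE; apply/esym/CrealP/complex_realP; eexists.
Qed.

Let char_AC : char_poly AC = \prod_(i < n) ('X - (toC (lam i))%:P).
Proof.
rewrite -map_char_poly A_eig.1 rmorph_prod /=.
by apply: eq_bigr => i _; rewrite rmorphB /= map_polyX map_polyC.
Qed.

Lemma diag_le_last_eigenvalue (i j : 'I_n) :
  (forall k : 'I_n, (k <= i)%N) -> A j j <= lam i.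
Proof.
move=> last_i; rewrite -lecR.
have -> : ((A j j)%:C)%C = AC j j by rewrite mxE.
apply: diag_le_max_eigenvalue AC_herm char_AC _ _ _ => k.
by rewrite lecR A_eig.2.
Qed.

Lemma eigenvalue_le_tail_bound (i : 'I_n) (m : R) :
    (forall j k : 'I_n, (rev_ord i <= j)%N -> (rev_ord i <= k)%N -> `|A j k| <= m) ->
  lam i <= i.+1%:R * m.
Proof.
move=> A_le.
have lamC_mono (j k : 'I_n) : (j <= k)%N -> toC (lam j) <= toC (lam k).
  by move=> jk; rewrite lecR A_eig.2.
have [v [v0 v_tail le_v]] := exists_tail_vector AC_herm char_AC lamC_mono i.
set N := \sum_j _ in le_v.
have N_gt0 : 0 < N.
  have /rV0Pn[j vj] := v0.
  rewrite /N (bigD1 j) //= ltr_pwDl ?exprn_gt0 ?normr_gt0 //.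
  by apply: sumr_ge0 => k _; rewrite exprn_ge0.
(* Being comparable with the real number [lam i * N] makes the form real, hence at most its norm;
   the positive factor [N] then cancels. *)
have q_real : (v *m AC *m v^t*)%sesqui 0 0 \is Num.real.
  rewrite (ger_real le_v) realM //; last exact: gtr0_real.
  by apply/complex_realP; eexists.
have := le_trans le_v (real_ler_norm q_real).
have AC_le : {in [set j : 'I_n | (rev_ord i <= j)%N] &,
    forall j k, `|AC j k| <= toC m}.
  move=> j k; rewrite !inE => ij ik; rewrite mxE.
  by rewrite normc_def /= expr0n addr0 sqrtr_sqr lecR A_le.
move=> /le_trans /(_ (norm_quadratic_form_le _ AC_le)).
rewrite card_tail ler_pM2r // -(rmorph_nat toC) -rmorphM lecR mulrC; apply.
by move=> j; rewrite inE -ltnNge; exact: v_tail.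
Qed.

End RealSymmetric.

Local Open Scope classical_set_scope.

(* Indices are 0-based: k = 1..n is i.+1 for i : 'I_n, and x_{n-k+1} is
   x (rev_ord i); x_1 and lambda_n are at Ordinal n_gt0 and its rev_ord. *)
Theorem theorem5p4 (d : Order.disp_t) (P : latticeType d) (R : realType)
    (P_infinite : infinite_set [set: P])
    (P_locally_finite : locally_finite P)
    (n : nat) (n_gt0 : (0 < n)%N)
    (x : 'I_n -> P)
    (x_distinct : injective x)
    (x_ordered : forall i j : 'I_n, (x i <= x j)%O -> (i <= j)%N)
    (f : P -> R)
    (f_ge0 : forall p : P, 0 <= f p)
    (f_rev : order_reversing_on (joincl (range x)) f)
    (f_decr : forall i j : 'I_n, (i <= j)%N -> f (x j) <= f (x i))
    (lam : 'I_n -> R)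
    (lam_eig : ordered_eigenvalues (join_matrix x f) lam) :
  (forall i : 'I_n, lam i <= (i.+1)%:R * f (x (rev_ord i)))
  /\ f (x (Ordinal n_gt0)) <= lam (rev_ord (Ordinal n_gt0)).
Proof.
have A_sym : (join_matrix x f)^T = join_matrix x f.
  by apply/matrixP => i j; rewrite !mxE joinC.
have sub_joincl : range x `<=` joincl (range x) by exact: sub_smallest.
(* An intersection of join-closed sets is join-closed. *)
have joincl_closed : Defs.join_closed (joincl (range x)).
  move=> a b ja jb T [T_join xT].
  exact: (T_join _ _ (ja T (conj T_join xT)) (jb T (conj T_join xT))).
have join_le i j : f (Order.join (x i) (x j)) <= f (x i).
  by apply: f_rev; rewrite ?leUl //; [|apply: joincl_closed]; apply: sub_joincl; eexists.
split=> [i|].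
  (* On the tail block, each entry is at most [f (x j)], which is at most [f (x (rev_ord i))]
     because [rev_ord i <= j]. *)
  apply: eigenvalue_le_tail_bound A_sym lam_eig _ _ _ => j k ij _.
  by rewrite mxE ger0_norm // (le_trans (join_le _ _)) // f_decr.
rewrite [leLHS](_ : _ = join_matrix x f (Ordinal n_gt0) (Ordinal n_gt0)).
  apply: diag_le_last_eigenvalue A_sym lam_eig _ _ _ => k.
  by rewrite /= subn1 -ltnS prednK.
by rewrite mxE joinxx.
Qed.
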